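(* Let $(X,M,* )$ be a fuzzy metric space such that $a*b\neq0$ whenever $a\neq0$ and $b\neq0$ ($a,b\in[0,1]$), and let $n\geq 0$ be an integer. Then $\operatorname{asdim}X\leq n$ implies all of the following conditions: \begin{enumerate} \item for every $r\in(0,1)$ and $t>0$, there exists a uniformly bounded cover $\mathcal{U}$ of $X$ with $(r,t)$-multiplicity $\leq n+1$; \item for every $r\in(0,1)$ and $t>0$, there exists a uniformly bounded cover $\mathcal{V}$ of $X$ with Lebesgue pair $r,t$ and multiplicity $\leq n+1$; \item for every uniformly bounded cover $\mathcal{U}$ of $X$, there is a uniformly bounded cover $\mathcal{V}$ of $X$ of multiplicity $\leq n+1$ such that $\mathcal{U}$ refines $\mathcal{V}$. \end{enumerate}
   Context: A continuous $t$-norm is a binary operation $*:[0,1]\times[0,1]\to[0,1]$ that is associative, commutative and continuous, satisfies $a*1=a$ for all $a\in[0,1]$, and satisfies $a*b\leq c*d$ whenever $a\leq c$ and $b\leq d$. A fuzzy metric space (in the sense of George and Veeramani) is a triple $(X,M,* )$ where $X$ is a set, $*$ is a continuous $t$-norm, and $M:X\times X\times(0,\infty)\to[0,1]$ satisfies for all $x,y,z\in X$ and all $s,t>0$: (1) $M(x,y,t)>0$; (2) $M(x,y,t)=1$ if and only if $x=y$; (3) $M(x,y,t)=M(y,x,t)$; (4) $M(x,y,t)*M(y,z,s)\leq M(x,z,t+s)$; (5) $M(x,y,\cdot)$ is continuous on $(0,\infty)$. For $x\in X$, $r\in(0,1)$, $t>0$, the ball is $B(x,r,t)=\{y\in X\mid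 M(x,y,t)>1-r\}$. A family $\mathcal{U}$ of subsets of $X$ is uniformly bounded if there exist $r\in(0,1)$ and $t>0$ such that $M(x,y,t)>1-r$ for all $x,y\in U$ and all $U\in\mathcal{U}$. Two subsets $U,U'$ are $(r,t)$-disjoint if $M(U,U',t)<1-r$, where $M(U,U',t)=\sup\{M(x,y,t)\mid x\in U,\,y\in U'\}$ (with $\sup\emptyset=0$); a family is $(r,t)$-disjoint if any two distinct elements of it are. For an integer $n\geq0$, $\operatorname{asdim}X\leq n$ means: for every $r\in(0,1)$ and $t>0$ there exist $(r,t)$-disjoint families $\mathcal{U}^0,\dots,\mathcal{U}^n$ of subsets of $X$ such that $\bigcup_i\mathcal{U}^i$ is a uniformly bounded cover of $X$. The $(r,t)$-multiplicity of a cover $\mathcal{U}$ of $X$ is the largest integer $m$ such that there exists $x\in X$ for which $B(x,r,t)$ meets $m$ of the sets in $\mathcal{U}$ (so $(r,t)$-multiplicity $\leq n+1$ means every ball $B(x,r,t)$ meets at most $n+1$ elements of $\mathcal{U}$). The multiplicity of a cover is the largest number of elements of the cover containing a common point of $X$. A Lebesgue pair of a cover $\mathcal{U}$ is a pair $r\in(0,1)$, $t>0$ such that for every $x\in X$ there is $U\in\mathcal{U}$ with $B(x,r,t)\subseteq U$. A cover $\mathcal{U}$ refines a cover $\mathcal{V}$ if every element of $\mathcal{U}$ is contained in some element of $\mathcal{V}$. *)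

(* Defs.v *)
From HB Require Import structures.
From mathcomp Require Import all_boot all_order all_algebra.
From mathcomp Require Import all_classical all_reals all_analysis.

Set Implicit Arguments.
Unset Strict Implicit.
Unset Printing Implicit Defensive.

Import Order.TTheory GRing.Theory Num.Theory.
Import numFieldNormedType.Exports.

Local Open Scope classical_set_scope.
Local Open Scope ring_scope.
Local Open Scope card_scope.

(* A partial operation [0,1] x [0,1] -> [0,1] is encoded as a total function on
   R of which only the values on the unit interval are constrained; likewise
   M x y t is only constrained for t > 0. *)

Definition unit_itv {R : realType} : set R := [set a | 0 <= a <= 1].

Record continuous_tnorm {R : realType} (op : R -> R -> R) : Prop := {
  tnorm_unit : forall (a b : R), unit_itv a -> unit_itv b -> unit_itv (op a b);
  tnormA : forall (a b c : R), unit_itv a -> unit_itv b -> unit_itv c ->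
    op a (op b c) = op (op a b) c;
  tnormC : forall a b, unit_itv a -> unit_itv b -> op a b = op b a;
  tnorm_continuous :
    {within unit_itv `*` unit_itv, continuous (fun p : R * R => op p.1 p.2)};
  tnorm1 : forall (a : R), unit_itv a -> op a 1 = a;
  tnorm_le : forall (a b c d : R),
    unit_itv a -> unit_itv b -> unit_itv c -> unit_itv d ->
    a <= c -> b <= d -> op a b <= op c d
}.

Record fuzzy_metric_space {R : realType} (X : Type) (M : X -> X -> R -> R)
    (op : R -> R -> R) : Prop := {
  fm_tnorm : continuous_tnorm op;
  fm_unit : forall (x y : X) (t : R), 0 < t -> unit_itv (M x y t);
  fm_gt0 : forall (x y : X) (t : R), 0 < t -> 0 < M x y t;
  fm_eq1 : forall (x y : X) (t : R), 0 < t -> M x y t = 1 <-> x = y;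
  fm_sym : forall (x y : X) (t : R), 0 < t -> M x y t = M y x t;
  fm_triangle : forall (x y z : X) (t s : R), 0 < t -> 0 < s ->
    op (M x y t) (M y z s) <= M x z (t + s);
  fm_continuous : forall x y, {within [set t | 0 < t], continuous (M x y)}
}.

Section FuzzyNotions.
Context {R : realType} {X : Type} (M : X -> X -> R -> R).
Implicit Types (r t : R) (U V : set X) (F G : set (set X)).

Definition fuzzy_ball x r t : set X := [set y | M x y t > 1 - r].

Definition is_cover F : Prop := \bigcup_(U in F) U = setT.

Definition uniformly_bounded F : Prop :=
  exists r t, [/\ 0 < r < 1, 0 < t &
    forall U, F U -> forall x y, U x -> U y -> M x y t > 1 - r].

(* [sup set0 = 0] in the library; nonempty instances are bounded by 1. *)
Definition set_M U V t : R := sup [set M x y t | x in U & y in V].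

Definition rt_disjoint r t F : Prop :=
  forall U V, F U -> F V -> U <> V -> set_M U V t < 1 - r.

Definition asdim_le (n : nat) : Prop :=
  forall r t, 0 < r < 1 -> 0 < t ->
  exists F : 'I_n.+1 -> set (set X),
    [/\ forall i, rt_disjoint r t (F i),
        is_cover (\bigcup_i F i) &
        uniformly_bounded (\bigcup_i F i)].

Definition rt_multiplicity_le r t F (m : nat) : Prop :=
  forall x, [set U | F U /\ fuzzy_ball x r t `&` U !=set0] #<= `I_m.

Definition multiplicity_le F (m : nat) : Prop :=
  forall x, [set U | F U /\ U x] #<= `I_m.

Definition lebesgue_pair r t F : Prop :=
  [/\ 0 < r < 1, 0 < t &
    forall x, exists2 U, F U & fuzzy_ball x r t `<=` U].

Definition refines F G : Prop :=
  forall U, F U -> exists2 V, G V & U `<=` V.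

End FuzzyNotions.

(* Main.v *)
(* Since [op] has no zero divisors, a positive lower bound on closeness survives
   concatenation of steps, so closeness parameters can be composed as in a metric
   space. If the families U^0, ..., U^n are disjoint at the scale obtained by
   composing (r, t) with itself, a ball B(x, r, t) meets at most one member of
   each, which bounds the (r, t)-multiplicity of their union. Replacing each U by
   the union of the balls B(u, r, t), u in U, turns (r, t)-multiplicity into
   multiplicity and makes (r, t) a Lebesgue pair; and a cover bounded by (r, t)
   refines any cover having (r, t) as a Lebesgue pair. *)

Require Import Defs.
From HB Require Import structures.
From mathcomp Require Import all_boot all_order all_algebra.
From mathcomp Require Import all_classical all_reals all_analysis.
From mathcomp Require Import lra.

Import Order.TTheory GRing.Theory Num.Theory.
Import numFieldNormedType.Exports.

Local Open Scope classical_set_scope.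
Local Open Scope ring_scope.

Local Open Scope card_scope.

Lemma card_le_II_inj {T : Type} {A : set T} {m : nat} (f : T -> nat) :
  (forall x, A x -> (f x < m)%N) -> {in A &, injective f} -> A #<= `I_m.
Proof.
move=> fm /inj_card_eq fA.
rewrite -(card_le_eql fA); apply: subset_card_le => _ [x Ax <-].
exact: fm.
Qed.

Section FuzzyMetric.
Context {R : realType} {X : Type} {M : X -> X -> R -> R} {op : R -> R -> R}.
Context (hM : fuzzy_metric_space M op).

Lemma fuzzy_triangle_ge (a b s t : R) (x y z : X) :
  unit_itv a -> unit_itv b -> 0 < s -> 0 < t ->
  a <= M x y s -> b <= M y z t -> op a b <= M x z (s + t).
Proof.
move=> ua ub s0 t0 aM bM; apply: le_trans (fm_triangle hM x y z s0 t0).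
by apply: (tnorm_le (fm_tnorm hM)) => //; exact: (fm_unit hM).
Qed.

Lemma le_set_M (t : R) (U V : set X) (x y : X) :
  0 < t -> U x -> V y -> M x y t <= set_M M U V t.
Proof.
move=> t0 Ux Vy; apply: ub_le_sup; last by exists x => //; exists y.
by exists 1 => _ [u _ [v _ <-]]; have /andP[] := fm_unit hM u v t0.
Qed.

Lemma fuzzy_ball_sym (r t : R) (x y : X) :
  0 < t -> fuzzy_ball M x r t y -> fuzzy_ball M y r t x.
Proof. by move=> t0; rewrite /fuzzy_ball/= (fm_sym hM _ _ t0). Qed.

Lemma fuzzy_ball_center (r t : R) (x : X) :
  0 < r -> 0 < t -> fuzzy_ball M x r t x.
Proof.
move=> r0 t0; rewrite /fuzzy_ball/= (fm_eq1 hM x x t0).2//.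
by rewrite gtrBl.
Qed.

Lemma tnorm_lel (a b : R) : unit_itv a -> unit_itv b -> op a b <= a.
Proof.
move=> ua ub; have u1 : unit_itv (1 : R) by rewrite /unit_itv/= ler01 lexx.
rewrite -[leRHS](tnorm1 (fm_tnorm hM) ua).
by apply: (tnorm_le (fm_tnorm hM)) => //; have /andP[] := ub.
Qed.

(** Points [u] of [U] and [v] of [V] in the ball around [x] satisfy [M u v (t + t) >= op (1 - r) (1
    - r) >= 1 - r'] by the triangle inequality through [x], which disjointness forbids for distinct
    members. *)
Lemma rt_disjoint_eq (r r' t : R) (F : set (set X)) (x : X) (U V : set X) :
  0 < r < 1 -> 0 < t -> 1 - r' <= op (1 - r) (1 - r) ->
  rt_disjoint M r' (t + t) F -> F U -> F V ->
  fuzzy_ball M x r t `&` U !=set0 -> fuzzy_ball M x r t `&` V !=set0 -> U = V.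
Proof.
move=> /andP[r0 r1] t0 rr' dF FU FV [u [xu Uu]] [v [xv Vv]].
apply: contrapT => UV; have := dF _ _ FU FV UV; apply/negP; rewrite -leNgt.
apply: (le_trans rr'); apply: le_trans (le_set_M _ _ _ _ _ _ Uu Vv); last lra.
have ur : unit_itv (1 - r) by rewrite /unit_itv/=; lra.
by apply: (@fuzzy_triangle_ge _ _ _ _ u x v) => //; apply: ltW => //;
  exact: fuzzy_ball_sym.
Qed.

Definition fuzzy_nbhd (r t : R) (U : set X) : set X :=
  \bigcup_(x in U) fuzzy_ball M x r t.

Lemma lebesgue_pair_fuzzy_nbhd (r t : R) (F : set (set X)) :
  0 < r < 1 -> 0 < t -> is_cover F ->
  lebesgue_pair M r t (fuzzy_nbhd r t @` F).
Proof.
move=> r01 t0 cF; split=> // x.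
have [U FU Ux] : (\bigcup_(U in F) U) x by rewrite cF.
by exists (fuzzy_nbhd r t U); [exists U|move=> y xy; exists x].
Qed.

Lemma lebesgue_pair_cover (r t : R) (F : set (set X)) :
  lebesgue_pair M r t F -> is_cover F.
Proof.
move=> [/andP[r0 _] t0 LF]; rewrite /is_cover -subTset => x _.
by have [U FU xU] := LF x; exists U => //; apply/xU/fuzzy_ball_center.
Qed.

(** By symmetry of [M], a point [x] in the neighbourhood of [U] has a ball that meets [U]; taking
    images under [fuzzy_nbhd] can only merge members. *)
Lemma multiplicity_le_fuzzy_nbhd (r t : R) (F : set (set X)) (m : nat) :
  0 < t -> rt_multiplicity_le M r t F m ->
  multiplicity_le (fuzzy_nbhd r t @` F) m.
Proof.
move=> t0 mF x; apply: card_le_trans (mF x).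
apply: card_le_trans (card_image_le (fuzzy_nbhd r t) _).
apply: subset_card_le => _ [[U FU <-] [u Uu ux]]; exists U => //.
by split => //; exists u; split => //; exact: fuzzy_ball_sym.
Qed.

(** A nonempty [U] lies in the ball around any of its points. An empty [U] still needs some member
    of [G], and a point of [X] supplies one. *)
Lemma refines_lebesgue_pair (r t : R) (F G : set (set X)) :
  inhabited X -> lebesgue_pair M r t G ->
  (forall U, F U -> forall x y, U x -> U y -> M x y t > 1 - r) -> refines F G.
Proof.
move=> [x0] [_ _ LG] bF U FU.
have [[x Ux]|/set0P/negP/negPn/eqP ->] := pselect (U !=set0); last first.
  by have [V GV _] := LG x0; exists V.
by have [V GV xV] := LG x; exists V => // y Uy; exact/xV/(bF U).
Qed.

Context (hop : forall a b : R, unit_itv a -> unit_itv b ->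
  a <> 0 -> b <> 0 -> op a b <> 0).

Lemma tnorm_gt0 (a b : R) :
  unit_itv a -> unit_itv b -> 0 < a -> 0 < b -> 0 < op a b.
Proof.
move=> ua ub a0 b0; have /andP[ab0 _] := tnorm_unit (fm_tnorm hM) ua ub.
by rewrite lt_neqAle ab0 eq_sym andbT; apply/eqP/hop => //; apply/eqP/lt0r_neq0.
Qed.

Lemma uniformly_bounded_fuzzy_nbhd (r t : R) (F : set (set X)) :
  0 < r < 1 -> 0 < t -> uniformly_bounded M F ->
  uniformly_bounded M (fuzzy_nbhd r t @` F).
Proof.
move=> r01 t0 [s [w [s01 w0 bF]]].
have ur : unit_itv (1 - r) by rewrite /unit_itv/=; lra.
have us : unit_itv (1 - s) by rewrite /unit_itv/=; lra.
have ua := tnorm_unit (fm_tnorm hM) ur us.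
have a0 : 0 < op (1 - r) (1 - s) by apply: tnorm_gt0 => //; lra.
have b0 : 0 < op (op (1 - r) (1 - s)) (1 - r) by apply: tnorm_gt0 => //; lra.
have /andP[_ b1] := tnorm_unit (fm_tnorm hM) ua ur.
set b := op _ (1 - r) in b0 b1.
(* The chain [x], [u], [v], [y] gives only [b <= M x y (t + w + t)]; halving [b] makes the bound
   strict. *)
exists (1 - b / 2), (t + w + t); split; [lra|lra|].
move=> _ [U FU <-] x y [u Uu ux] [v Uv vy].
have : b <= M x y (t + w + t); last lra.
apply: (@fuzzy_triangle_ge _ _ _ _ x v y) => //; [lra| |exact: ltW].
apply: (@fuzzy_triangle_ge _ _ _ _ x u v) => //; last exact/ltW/(bF U).
exact/ltW/fuzzy_ball_sym.
Qed.

Lemma asdim_rt_multiplicity (n : nat) (r t : R) :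
  asdim_le M n -> 0 < r < 1 -> 0 < t ->
  exists F : set (set X),
    [/\ is_cover F, uniformly_bounded M F & rt_multiplicity_le M r t F n.+1].
Proof.
move=> hdim r01 t0.
have ur : unit_itv (1 - r) by rewrite /unit_itv/=; lra.
have c0 : 0 < op (1 - r) (1 - r) by apply: tnorm_gt0 => //; lra.
(* With [c0], this places [1 - op (1 - r) (1 - r)] strictly between 0 and 1, as [hdim] requires. *)
have c1 := tnorm_lel _ _ ur ur.
have [||F [dF cF bF]] := hdim (1 - op (1 - r) (1 - r)) (t + t); [lra|lra|].
exists (\bigcup_i F i); split => // x.
(* A set may belong to several families, so [g] fixes one index for each; [ord0] is a dummy value
   outside the union. Members that meet the ball and share an index are equal, so [g] is injective
   on them. *)
have /choice[g gF] U : exists i, (\bigcup_i F i) U -> F i U.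
  have [[i _ FiU]|nFU] := pselect ((\bigcup_i F i) U); first by exists i.
  by exists ord0 => /nFU.
apply: (card_le_II_inj (fun U => g U : nat)) => // U V.
rewrite !inE/= => -[/gF FU xU] [/gF FV xV] /val_inj gUV.
apply: (rt_disjoint_eq _ _ _ _ _ _ _ r01 t0 _ (dF (g U))) xU xV => //.
  by rewrite opprB addrC subrK.
by rewrite gUV.
Qed.

Lemma asdim_lebesgue_multiplicity (n : nat) (r t : R) :
  asdim_le M n -> 0 < r < 1 -> 0 < t ->
  exists G : set (set X),
    [/\ is_cover G, uniformly_bounded M G,
        lebesgue_pair M r t G & multiplicity_le G n.+1].
Proof.
move=> hdim r01 t0.
have [F [cF bF mF]] := asdim_rt_multiplicity _ _ _ hdim r01 t0.
have LG := lebesgue_pair_fuzzy_nbhd _ _ _ r01 t0 cF.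
exists (fuzzy_nbhd r t @` F); split => //.
- exact: lebesgue_pair_cover LG.
- exact: uniformly_bounded_fuzzy_nbhd.
- exact: multiplicity_le_fuzzy_nbhd.
Qed.

End FuzzyMetric.

Local Close Scope card_scope.

Theorem theorem4p5 (R : realType) (X : Type) (M : X -> X -> R -> R)
    (op : R -> R -> R) (n : nat)
    (hM : fuzzy_metric_space M op)
    (hop : forall a b : R, unit_itv a -> unit_itv b ->
       a <> 0 -> b <> 0 -> op a b <> 0)
    (hdim : asdim_le M n) :
  [/\ forall r t : R, 0 < r < 1 -> 0 < t ->
        exists F : set (set X),
          [/\ is_cover F, uniformly_bounded M F &
              rt_multiplicity_le M r t F n.+1],
      forall r t : R, 0 < r < 1 -> 0 < t ->
        exists G : set (set X),
          [/\ is_cover G, uniformly_bounded M G,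
              lebesgue_pair M r t G & multiplicity_le G n.+1] &
      forall F : set (set X), is_cover F -> uniformly_bounded M F ->
        exists G : set (set X),
          [/\ is_cover G, uniformly_bounded M G,
              multiplicity_le G n.+1 & refines F G]].
Proof.
split=> [r t r01 t0|r t r01 t0|F _ bF].
- exact: (asdim_rt_multiplicity hM hop _ _ _ hdim).
- exact: (asdim_lebesgue_multiplicity hM hop _ _ _ hdim).
have [iX|nX] := pselect (inhabited X); last first.
  have half01 : 0 < (2^-1 : R) < 1 by lra.
  (* On an empty space the cover produced from [hdim] may have no member at all,
     so it cannot contain the empty member that [F] may have. *)
  have noX (x : X) : False by exact: nX (inhabits x).
  exists [set set0]; split.
  - by rewrite /is_cover -subTset => x; case: (noX x).
  - by exists 2^-1, 1; split => // U _ x; case: (noX x).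
  - by move=> x; case: (noX x).
  - by move=> U _; exists set0 => // x; case: (noX x).
(* The parameters that bound [F] are prescribed as the Lebesgue pair of [G]. *)
have [r [t [r01 t0 bF']]] := bF.
have [G [cG bG LG mG]] :=
  asdim_lebesgue_multiplicity hM hop _ _ _ hdim r01 t0.
by exists G; split => //; exact: refines_lebesgue_pair LG bF'.
Qed.
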